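(* Let $k\ge1$. Consider a quasi-Newton method with exact linesearch applied to $\min_{x\in\mathbb{R}^n}\frac12x^THx+c^Tx$, where $H=H^T\succ0$, started at $x_0$ with $B_0=I$, so that $p_0=p_0^{CG}=-g_0$, and suppose $g_0,\dots,g_k$ are nonzero. Assume that $p_i\parallel p_i^{CG}$ for all $i\le k-1$; that the symmetric matrix $B_{k-1}=I+V_{k-1}$ satisfies $\mathcal{R}(V_{k-1})\subseteq\mathcal{K}_k(p_0,H)$; that a solution $p_k$ is obtained from $B_kp_k=-g_k$; that $B_k=B_{k-1}+U_k=I+V_{k-1}+U_k$; and that $U_k$ belongs to the one-parameter Broyden family for some $\phi_k$, where $\phi_k\neq-(p_{k-1}^TB_{k-1}p_{k-1})/(g_k^Tg_k)$. Then the nonzero parameter $\delta_k$ in $p_k=\delta_kp_k^{CG}$ is given by $$\delta_k(\phi_k)=\frac{1}{1+\phi_k\,\frac{g_k^Tg_k}{p_{k-1}^TB_{k-1}p_{k-1}}}.$$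
   Context: Problem: minimize $q(x)=\frac12x^THx+c^Tx$ over $\mathbb{R}^n$ with $H=H^T\succ0$; gradient $g(x)=Hx+c$, $g_k=g(x_k)$. All methods use $x_{k+1}=x_k+\alpha_kp_k$ with exact linesearch $\alpha_k=-\frac{p_k^Tg_k}{p_k^THp_k}$. Quasi-Newton method: in each iteration $i$ the direction $p_i$ is obtained as a solution of $B_ip_i=-g_i$ with $B_i$ symmetric. One-parameter Broyden family with parameter $\phi_k\in\mathbb{R}$: writing $p=p_{k-1}$, $B=B_{k-1}$, $$U_k=\frac{Hpp^TH}{p^THp}-\frac{Bpp^TB}{p^TBp}+\phi_k\,(p^TBp)\,ww^T,\qquad w=\frac{Hp}{p^THp}-\frac{Bp}{p^TBp}.$$ Conjugate gradient method (CG): started at the same $x_0$ with exact linesearch, it uses the directions $p_0^{CG}=-g_0$ and $p_k^{CG}=-g_k+\beta_{k-1}p_{k-1}^{CG}$, $\beta_{k-1}=\frac{(p_{k-1}^{CG})^THg_k}{(p_{k-1}^{CG})^THp_{k-1}^{CG}}$ for $k\geq 1$, where here $g_k$ is the gradient at the $k$-th CG iterate. Notation: $p\parallel p'$ means $p=\delta p'$ for some nonzero scalar $\delta$. $\mathcal{K}_k(b,A)=\mathrm{span}\{b,Ab,\dots,A^{k-1}b\}$ is the Krylov subspace. $\mathcal{R}(M)$ is the range space of the matrix $M$.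
   Formalization: As B_k may be singular, p_k need not be a multiple of p_k^CG; so it is proved that δ_k is nonzero, δ_k p_k^CG solves B_k p = -g_k, any p_k that is a multiple of p_k^CG has this factor δ_k, and p_k = δ_k p_k^CG when B_k is nonsingular. *)

(* Defs.v *)
From HB Require Import structures.
From mathcomp Require Import all_boot all_order all_algebra.
From mathcomp Require Import reals.

Set Implicit Arguments.
Unset Strict Implicit.
Unset Printing Implicit Defensive.

Import Order.TTheory GRing.Theory Num.Theory.
Local Open Scope ring_scope.

Section Defs.
Context {R : realType} {n : nat}.
Implicit Types (H A B M : 'M[R]_n) (b c p u v x : 'cV[R]_n).

Definition dot u v : R := (u^T *m v) 0 0.

Definition sym_posdef H : Prop :=
  H^T = H /\ forall u, u != 0 -> 0 < dot u (H *m u).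

(* The objective function is [q x = (1/2) x^T H x + c^T x], with [H^T = H]. *)
Definition grad H c x : 'cV[R]_n := H *m x + c.

Definition exact_step H c x p : R :=
  - dot p (grad H c x) / dot p (H *m p).

Definition ls_iterate H c x p : 'cV[R]_n := x + exact_step H c x p *: p.

(* The [k]-th (iterate, direction) pair of the conjugate gradient method. *)
Fixpoint cg H c (x0 : 'cV[R]_n) (k : nat) : 'cV[R]_n * 'cV[R]_n :=
  if k is k'.+1 then
    let: (x, p) := cg H c x0 k' in
    let x' := ls_iterate H c x p in
    let g' := grad H c x' in
    let beta := dot p (H *m g') / dot p (H *m p) in
    (x', - g' + beta *: p)
  else (x0, - grad H c x0).

Definition cg_dir H c x0 k : 'cV[R]_n := (cg H c x0 k).2.

(* Directions [p 0 .. p k] and iterates [x 0 .. x k] of a quasi-Newton method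
   with matrices [B 0 .. B k]; values at indices above [k] are unconstrained.
   The matrices may be singular: [p i] is then one of the solutions. *)
Definition quasi_newton H c (k : nat)
    (x p : nat -> 'cV[R]_n) (B : nat -> 'M[R]_n) : Prop :=
  (forall i, (i <= k)%N ->
     (B i)^T = B i /\ B i *m p i = - grad H c (x i)) /\
  (forall i, (i < k)%N -> x i.+1 = ls_iterate H c (x i) (p i)).

Definition broyden_w H B p : 'cV[R]_n :=
  (dot p (H *m p))^-1 *: (H *m p) - (dot p (B *m p))^-1 *: (B *m p).

Definition broyden_update H B p (phi : R) : 'M[R]_n :=
  (dot p (H *m p))^-1 *: (H *m p *m p^T *m H)
  - (dot p (B *m p))^-1 *: (B *m p *m p^T *m B)
  + (phi * dot p (B *m p)) *: (broyden_w H B p *m (broyden_w H B p)^T).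

Definition parallel u v : Prop := exists2 d : R, d != 0 & u = d *: v.

Definition krylov (k : nat) b A : {vspace 'cV[R]_n} :=
  <<[seq A ^+ i *m b | i <- iota 0 k]>>%VS.

(* The range (column space) of [M]. *)
Definition range M : {vspace 'cV[R]_n} := limg (linfun (mulmx M : 'cV[R]_n -> 'cV[R]_n)).

End Defs.

(* Main.v *)
Require Import Defs.
From mathcomp Require Import all_boot all_order all_algebra.
From mathcomp Require Import reals.
From mathcomp Require Import ring.
Import Order.TTheory GRing.Theory Num.Theory.
Local Open Scope ring_scope.

(** Exact linesearch is invariant under scaling of the direction, so the
    iterates are those of CG up to index [k], and [g_k] is orthogonal to
    [K_k(p_0, H)]; hence [V_{k-1} g_k = 0].  Moreover
    [Hp = (g_k - g_{k-1}) / alpha_{k-1}] and [B_{k-1} p = - g_{k-1}] turn [w]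
    into [g_k / (p^T B_{k-1} p)], so that
    [B_k p_k^CG = - (1 + phi g_k^T g_k / (p^T B_{k-1} p)) g_k]. *)

(** * The inner product on column vectors *)

Section Dot.
Context {R : realType} {n : nat}.
Implicit Types (u v w : 'cV[R]_n) (A : 'M[R]_n) (a : R).

Lemma dotC u v : dot u v = dot v u.
Proof. by rewrite /dot !mxE; apply: eq_bigr => i _; rewrite !mxE mulrC. Qed.

Lemma dotDr u v w : dot u (v + w) = dot u v + dot u w.
Proof. by rewrite /dot mulmxDr mxE. Qed.

Lemma dotZr u a v : dot u (a *: v) = a * dot u v.
Proof. by rewrite /dot -scalemxAr mxE. Qed.

Lemma dotNr u v : dot u (- v) = - dot u v.
Proof. by rewrite -scaleN1r dotZr mulN1r. Qed.

Lemma dotBr u v w : dot u (v - w) = dot u v - dot u w.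
Proof. by rewrite dotDr dotNr. Qed.

Lemma dot0r u : dot u 0 = 0.
Proof. by rewrite -(scale0r 0) dotZr mul0r. Qed.

Lemma dotZl u a v : dot (a *: u) v = a * dot u v.
Proof. by rewrite dotC dotZr dotC. Qed.

Lemma dot_mulmxr A u v : A^T = A -> dot u (A *m v) = dot (A *m u) v.
Proof. by move=> sA; rewrite /dot trmx_mul sA mulmxA. Qed.

Lemma mul_col_tr u v w : u *m v^T *m w = dot v w *: u.
Proof. by rewrite -mulmxA [v^T *m w]mx11_scalar mul_mx_scalar. Qed.

Lemma dot_self_eq0 u : (dot u u == 0) = (u == 0).
Proof.
apply/eqP/eqP => [|->]; last exact: dot0r.
rewrite /dot mxE => /eqP; rewrite psumr_eq0 => [/allP h|i _]; last first.
  by rewrite mxE -expr2 sqr_ge0.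
apply/colP => i; have := h i (mem_index_enum i).
by rewrite !mxE -expr2 sqrf_eq0 => /eqP.
Qed.

Lemma dot_span_eq0 u v (s : seq 'cV[R]_n) :
  (forall w, w \in s -> dot u w = 0) -> v \in <<s>>%VS -> dot u v = 0.
Proof.
move=> us /(@coord_span _ _ _ (in_tuple s)) ->.
elim/big_rec: _ => [|i w _ uw]; first exact: dot0r.
by rewrite dotDr uw dotZr us ?mem_nth // mulr0 addr0.
Qed.

End Dot.

(** * Orthogonality and conjugacy in the conjugate gradient method *)

Section ConjugateGradient.
Context {R : realType} {n : nat}.
Variables (H : 'M[R]_n) (c x0 : 'cV[R]_n).
Hypothesis hH : sym_posdef H.

Local Notation X i := (cg H c x0 i).1.
Local Notation P i := (cg_dir H c x0 i).
Local Notation G i := (grad H c (X i)).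
Local Notation beta i := (dot (P i) (H *m G i.+1) / dot (P i) (H *m P i)).
Local Notation alpha i := (exact_step H c (X i) (P i)).

Lemma grad_ls_iterate x p :
  grad H c (ls_iterate H c x p)
  = grad H c x + exact_step H c x p *: (H *m p).
Proof. by rewrite /grad /ls_iterate mulmxDr -scalemxAr addrAC. Qed.

Lemma ls_iterateZ x p (d : R) :
  d != 0 -> ls_iterate H c x (d *: p) = ls_iterate H c x p.
Proof.
move=> d0; rewrite /ls_iterate scalerA; congr (_ + _ *: _).
rewrite /exact_step -scalemxAr !dotZl dotZr.
(* With zero curvature both steps are 0, since the inverse of 0 is 0. *)
have [->|pHp] := eqVneq (dot p (H *m p)) 0; first by rewrite !mulr0 invr0 !mulr0 mul0r.
by field; apply/andP.
Qed.

Lemma cg_iterS i : X i.+1 = ls_iterate H c (X i) (P i).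
Proof. by rewrite /cg_dir /=; case: (cg _ _ _ i). Qed.

Lemma cg_dirS i : P i.+1 = - G i.+1 + beta i *: P i.
Proof. by rewrite /cg_dir /=; case: (cg _ _ _ i). Qed.

Lemma cg_gradS i : G i.+1 = G i + alpha i *: (H *m P i).
Proof. by rewrite cg_iterS grad_ls_iterate. Qed.

Lemma dot_H_gt0 {u v} : dot u v != 0 -> 0 < dot u (H *m u).
Proof.
by move=> uv; apply: hH.2; apply: contraNneq uv => ->; rewrite dotC dot0r.
Qed.

Lemma dot_ls_grad x p :
  dot p (grad H c x) != 0 -> dot p (grad H c (ls_iterate H c x p)) = 0.
Proof.
move=> /dot_H_gt0 pHp; rewrite grad_ls_iterate dotDr dotZr /exact_step.
by rewrite mulfVK ?gt_eqF // subrr.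
Qed.

(** The recurrence read backwards makes each gradient a combination of the current direction and the
    previous one. *)
Lemma orthogonal_cg_grad {u : 'cV[R]_n} {j} :
  (forall i, (i <= j)%N -> dot u (P i) = 0) ->
  forall i, (i <= j)%N -> dot u (G i) = 0.
Proof.
move=> uP [|i] ij.
  by have := uP 0%N ij; rewrite /cg_dir /= dotNr => /eqP; rewrite oppr_eq0 => /eqP.
have -> : G i.+1 = beta i *: P i - P i.+1 by rewrite cg_dirS opprD opprK addrC subrK.
by rewrite dotBr dotZr !uP ?mulr0 ?subrr // ltnW.
Qed.

Lemma cg_dot_dir_grad j : (forall i, (i < j)%N -> dot (P i) (G j) = 0) ->
  dot (P j) (G j) = - dot (G j) (G j).
Proof.
case: j => [|j] h; first by rewrite /cg_dir /= dotC dotNr.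
by rewrite dotC cg_dirS dotDr dotNr dotZr [dot _ (P j)]dotC h ?mulr0 ?addr0.
Qed.

Lemma cg_H_dir i : alpha i != 0 ->
  H *m P i = (alpha i)^-1 *: (G i.+1 - G i).
Proof. by move=> a0; rewrite cg_gradS addrAC subrr add0r scalerA mulVf ?scale1r. Qed.

(** The three claims need one joint induction: conjugacy gives orthogonality to the next gradient,
    and nonzero steps let [H *m P i] be written as a gradient difference, which gives conjugacy of
    the next direction. *)
Lemma cg_conjugate {k} : (forall i, (i < k)%N -> G i != 0) ->
  forall j, (j <= k)%N ->
  [/\ forall i, (i < j)%N -> dot (P i) (G j) = 0,
      forall i, (i < j)%N -> dot (P i) (H *m P j) = 0 &
      forall i, (i < j)%N -> alpha i != 0].
Proof.
move=> G0; elim=> [|j IH] jk; first by split.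
have [PG PHP a0] := IH (ltnW jk).
have PGj : dot (P j) (G j) != 0.
  by rewrite cg_dot_dir_grad // oppr_eq0 dot_self_eq0 G0.
have pHp := dot_H_gt0 PGj.
have aj : forall i, (i < j.+1)%N -> alpha i != 0.
  move=> i; rewrite ltnS leq_eqVlt => /predU1P[->|/a0 //].
  by rewrite mulf_neq0 ?oppr_eq0 ?invr_eq0 // gt_eqF.
have PG1 i : (i < j.+1)%N -> dot (P i) (G j.+1) = 0.
  rewrite ltnS leq_eqVlt => /predU1P[->|ij].
    by rewrite cg_iterS dot_ls_grad.
  by rewrite cg_gradS dotDr dotZr PG // PHP // mulr0 addr0.
have GG1 i : (i <= j)%N -> dot (G j.+1) (G i) = 0.
  by apply: orthogonal_cg_grad => l lj; rewrite dotC PG1.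
split=> // i; rewrite ltnS leq_eqVlt => /predU1P[->|ij].
  (* For [i = j], [beta j] is exactly the coefficient that makes the product vanish. *)
  rewrite cg_dirS mulmxDr mulmxN -scalemxAr dotDr dotNr dotZr mulfVK ?gt_eqF //.
  by rewrite addNr.
rewrite cg_dirS mulmxDr mulmxN -scalemxAr dotDr dotNr dotZr (PHP i ij) mulr0 addr0.
(* For [i < j], [H] moves onto [P i] and produces [G i.+1 - G i]; both gradients have index at most
   [j], so [GG1] applies. *)
rewrite (dot_mulmxr _ _ _ hH.1) cg_H_dir; last by rewrite aj // ltnW.
by rewrite dotZl dotC dotBr !GG1 ?subrr ?mulr0 ?oppr0 // ltnW.
Qed.

(* Induction through [dot u (H^(j+1) p_0) = dot (H u) (H^j p_0)], which avoids
   describing the Krylov space as a span of CG directions. *)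
Lemma orthogonal_krylov_power j (u : 'cV[R]_n) :
  (forall i, (i < j)%N -> alpha i != 0) ->
  (forall i, (i <= j)%N -> dot u (P i) = 0) ->
  dot u (H ^+ j *m P 0%N) = 0.
Proof.
elim: j u => [|j IH] u a0 uP; first by rewrite mul1mx uP.
rewrite exprS -mulmxA (dot_mulmxr _ _ _ hH.1); apply: IH => i ij.
  exact/a0/ltnW.
rewrite -(dot_mulmxr _ _ _ hH.1) cg_H_dir ?a0 // dotZr dotBr.
by rewrite !(orthogonal_cg_grad uP) ?subrr ?mulr0 // leqW.
Qed.

Lemma cg_grad_orthogonal_krylov k v :
  (forall i, (i < k)%N -> G i != 0) ->
  v \in krylov k (P 0%N) H -> dot (G k) v = 0.
Proof.
move=> G0; have [PG _ a0] := cg_conjugate G0 k (leqnn k).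
apply: dot_span_eq0 => w /mapP[j]; rewrite mem_iota add0n => /andP[_ jk] ->.
apply: orthogonal_krylov_power => i ij; first exact/a0/(ltn_trans ij).
by rewrite dotC PG // (leq_ltn_trans ij).
Qed.

End ConjugateGradient.

(** * Transfer to the quasi-Newton method and its update *)

Lemma mulmx_range_eq0 (R : realType) (n : nat) (A : 'M[R]_n)
    (K : {vspace 'cV[R]_n}) (g : 'cV[R]_n) :
  A^T = A -> (range A <= K)%VS -> (forall v, v \in K -> dot g v = 0) ->
  A *m g = 0.
Proof.
(* By symmetry the squared norm of [A *m g] is the product of [g] with [A *m (A *m g)], a vector of
   the range. *)
move=> sA /subvP AK gK; apply/eqP; rewrite -dot_self_eq0 -dot_mulmxr //.
apply/eqP/gK/AK; have := memv_img (linfun (mulmx A)) (memvf (A *m g)).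
by rewrite lfunE.
Qed.

Lemma quasi_newton_iter_cg {R : realType} {n k : nat} {H : 'M[R]_n}
    {c : 'cV[R]_n} {x p : nat -> 'cV[R]_n} {B : nat -> 'M[R]_n} :
  quasi_newton H c k x p B ->
  (forall i, (i < k)%N -> parallel (p i) (cg_dir H c (x 0%N) i)) ->
  forall i, (i <= k)%N -> x i = (cg H c (x 0%N) i).1.
Proof.
move=> [_ xS] hpar; elim=> [//|i IH] ik.
have [d d0 pi] := hpar i ik.
by rewrite xS // pi ls_iterateZ // cg_iterS IH // ltnW.
Qed.

Theorem proposition3p8 (R : realType) (n : nat) (k : nat) (hk : (1 <= k)%N)
    (H : 'M[R]_n) (c : 'cV[R]_n) (hH : sym_posdef H)
    (x p : nat -> 'cV[R]_n) (B : nat -> 'M[R]_n)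
    (hQN : quasi_newton H c k x p B)
    (hB0 : B 0%N = 1%:M)
    (hg : forall i, (i <= k)%N -> grad H c (x i) != 0)
    (hpar : forall i, (i <= k.-1)%N -> parallel (p i) (cg_dir H c (x 0%N) i))
    (V : 'M[R]_n) (hV : B k.-1 = 1%:M + V)
    (hVrange : (range V <= krylov k (p 0%N) H)%VS)
    (phi : R)
    (hBk : B k = B k.-1 + broyden_update H (B k.-1) (p k.-1) phi)
    (hphi : phi != - (dot (p k.-1) (B k.-1 *m p k.-1)
                      / dot (grad H c (x k)) (grad H c (x k)))) :
  let gk := grad H c (x k) in
  let pk_cg := cg_dir H c (x 0%N) k in
  let delta := 1 / (1 + phi * (dot gk gk / dot (p k.-1) (B k.-1 *m p k.-1))) in
  [/\ delta != 0,
      B k *m (delta *: pk_cg) = - gk,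
      forall d : R, p k = d *: pk_cg -> d = delta
    & B k \in unitmx -> p k = delta *: pk_cg].
Proof.
case: k hk hQN hg hpar hV hVrange hBk hphi => [//|m] _ hQN hg hpar /= hV hVr hBk hphi.
set gk := grad H c (x m.+1) in hphi *; set q := cg_dir H c (x 0%N) m.+1 => /=.
have xE := quasi_newton_iter_cg hQN hpar.
have G0 i : (i < m.+1)%N -> grad H c (cg H c (x 0%N) i).1 != 0.
  by move=> im; rewrite -xE ?hg // ltnW.
have [PG PHP a0] := cg_conjugate H c (x 0%N) hH G0 m.+1 (leqnn _).
have [PGm _ _] := cg_conjugate H c (x 0%N) hH G0 m (leqnSn m).
have [dl dl0 pE] := hpar m (leqnn m).
have [sB Bp] := hQN.1 m (leqnSn m).
have gkE : grad H c (cg H c (x 0%N) m.+1).1 = gk by rewrite -xE.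
set gm := grad H c (x m) in Bp.
have gmE : grad H c (cg H c (x 0%N) m).1 = gm by rewrite -xE.
set P := cg_dir H c (x 0%N) m in pE.
have Pgm : dot P gm = - dot gm gm by rewrite -gmE cg_dot_dir_grad.
have Pgk : dot P gk = 0 by rewrite -gkE PG.
have gkgm : dot gk gm = 0.
  by rewrite -gmE; apply: (orthogonal_cg_grad _ _ _ (j := m)) => // i im; rewrite dotC -gkE PG.
have PHq : dot P (H *m q) = 0 by rewrite PHP.
set a := exact_step H c (cg H c (x 0%N) m).1 P.
have aN0 : a != 0 by rewrite a0.
have HP : H *m P = a^-1 *: (gk - gm) by rewrite cg_H_dir ?a0 // gkE gmE.
pose b := dot P (H *m gk) / dot P (H *m P).
have qE : q = - gk + b *: P by rewrite /q cg_dirS gkE.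
have gm0 : dot gm gm != 0 by rewrite dot_self_eq0 hg.
have gk0 : dot gk gk != 0 by rewrite dot_self_eq0 hg.
have Vgk : V *m gk = 0.
  apply: mulmx_range_eq0 hVr _ => [|v].
    by move: sB; rewrite hV linearD /= trmx1 => /addrI.
  rewrite -gkE => vK; apply: cg_grad_orthogonal_krylov G0 _ => //.
  (* The Krylov space in [hVr] starts from [p 0], which [B 0 = I] identifies with the first CG
     direction. *)
  have <- // : p 0%N = cg_dir H c (x 0%N) 0.
  rewrite -[RHS]opprK /cg_dir /= opprK.
  by have := (hQN.1 0%N isT).2; rewrite hB0 mul1mx.
have BP : B m *m P = - dl^-1 *: gm.
  by apply: (scalerI dl0); rewrite scalemxAr -pE Bp scalerA mulrN mulfV // scaleN1r.
set y := dot (p m) (B m *m p m) in hphi *.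
have yE : y = dl * dot gm gm by rewrite /y Bp pE dotNr dotZl Pgm mulrN opprK.
have yN0 : y != 0 by rewrite yE mulf_neq0.
(* The steplength and [dl] cancel, so both terms of [w] carry the factor [y^-1], and their [gm]
   parts cancel. *)
have wE : broyden_w H (B m) (p m) = y^-1 *: gk.
  rewrite /broyden_w -/y Bp pE -scalemxAr HP !dotZl !dotZr dotBr Pgk Pgm sub0r opprK.
  have -> : (dl * (dl * (a^-1 * dot gm gm)))^-1 *: (dl *: (a^-1 *: (gk - gm)))
            = y^-1 *: (gk - gm).
    by rewrite !scalerA yE; congr (_ *: _); field; rewrite gm0 dl0 aN0.
  by rewrite scalerN opprK -scalerDr subrK.
(* This is [hphi] multiplied by [dot gk gk / y]. *)
have DN0 : 1 + phi * (dot gk gk / y) != 0.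
  apply: contra hphi => /eqP e; rewrite -subr_eq0 opprK; apply/eqP.
  apply: (mulIf (mulf_neq0 gk0 (invr_neq0 yN0))).
  rewrite mul0r -[RHS]e; field; exact/andP.
set D := 1 + _ in DN0 *.
(* The [H] term of the update vanishes on [q] by conjugacy, the [B] term removes the [gm] component
   of [B m *m q], and the [w] term adds the [phi] part of [D]. *)
have Bkq : B m.+1 *m q = - D *: gk.
  rewrite hBk /broyden_update -/y wE !mulmxDl mulNmx -!scalemxAl.
  rewrite -[_ *m H *m q]mulmxA mul_col_tr.
  rewrite -[_ *m B m *m q]mulmxA mul_col_tr mul_col_tr.
  rewrite (dot_mulmxr _ _ _ sB) Bp [X in dot X (H *m q)]pE dotZl PHq.
  have -> : B m *m q = - gk - (b / dl) *: gm.
    rewrite qE mulmxDr -scalemxAr BP scalerA mulrN scaleNr mulmxN hV mulmxDl.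
    by rewrite mul1mx Vgk addr0.
  have -> : dot (y^-1 *: gk) q = - (y^-1 * dot gk gk).
    by rewrite dotZl qE dotDr dotNr dotZr [dot gk P]dotC Pgk mulr0 addr0 mulrN.
  have -> : dot (- gm) q = b * dot gm gm.
    rewrite dotC dotNr dotC qE dotDr dotNr dotZr [dot gm P]dotC Pgm dotC gkgm.
    by rewrite oppr0 add0r mulrN opprK.
  rewrite mulr0 scale0r scaler0 sub0r.
  have -> : y^-1 *: (b * dot gm gm *: - gm) = - ((b / dl) *: gm).
    rewrite !scalerN scalerA yE; congr (- (_ *: _)); field; exact/andP.
  rewrite opprK addrA subrK !scalerA -[X in X + _]scaleN1r -scalerDl.
  by congr (_ *: _); rewrite /D; field.
split.
- by rewrite div1r invr_neq0.
- by rewrite -scalemxAr Bkq scalerA div1r mulrN mulVf // scaleN1r.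
(* Comparing coefficients of the nonzero vector [gk] gives [d * D = 1], even if [B m.+1] is
   singular. *)
- move=> d pk; have := (hQN.1 m.+1 (leqnn _)).2.
  rewrite pk -scalemxAr Bkq -/gk scalerA -scaleN1r => /eqP.
  rewrite -subr_eq0 -scalerBl scaler_eq0 -dot_self_eq0 (negbTE gk0) orbF subr_eq0.
  rewrite mulrN eqr_opp => /eqP e; apply: (mulIf DN0); by rewrite e div1r mulVf.
- move=> Bu; rewrite -[LHS](mulKmx Bu) -[RHS](mulKmx Bu); congr (_ *m _).
  by rewrite (hQN.1 _ (leqnn _)).2 -/gk -scalemxAr Bkq scalerA div1r mulrN mulVf // scaleN1r.
Qed.
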